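(* In genus $3$, up to the space of degree $24$, $$\mathfrak{D}^{(3)}\subsetneq\mathfrak{A}^{(3)}\subsetneq\mathfrak{B}^{(3)},$$ that is, $\mathfrak{D}^{(3)}_{\le 24}\subsetneq\mathfrak{A}^{(3)}_{\le 24}\subsetneq\mathfrak{B}^{(3)}_{\le 24}$.
   Context: A binary code of length $n$ is a linear subspace of $\mathbb{F}_2^n$ with inner product $u\cdot v=\sum_i u_iv_i$; it is self-dual if it equals its dual. A Type II code is a binary self-dual code all of whose codewords have weight (number of nonzero coordinates) divisible by $4$. Two self-dual codes of length $n$ are neighbors if their intersection has dimension $\frac n2-1$. For $n\equiv 0\pmod 8$, $d_n^+$ is the Type II code of length $n$ spanned by the vectors with support $\{1,2,2i-1,2i\}$ for $2\le i\le n/2$, together with the vector $(1,0,1,0,\dots,1,0)$. For a Type II code $C$ of length $n$, its weight enumerator in genus $g$ is the homogeneous polynomial of degree $n$ in the $2^g$ variables $x_a$ ($a\in\mathbb{F}_2^g$, written as column vectors) $$W_C^{(g)}(x_a : a\in\mathbb{F}_2^g)=\sum_{u_1,\dots,u_g\in C}\ \prod_{a\in\mathbb{F}_2^g}x_a^{n_a(u_1,\dots,u_g)},$$ where $n_a(u_1,\dots,u_g)$ is the number of $i\in\{1,\dots,n\}$ with $(u_{1i},\dots,u_{gi})^T=a$. Define the following $\mathbb{C}$-subalgebras of $\mathbb{C}[x_a : a\in\mathbb{F}_2^g]$: $\mathfrak{B}^{(g)}$ is generated by all $W_C^{(g)}$ with $C$ a Type II code (of any length); $\mathfrak{D}^{(g)}$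 is generated by all $W_{d_n^+}^{(g)}$ with $n>0$, $n\equiv0\pmod 8$; $\mathfrak{A}^{(g)}$ is generated by all $W_C^{(g)}$ where, for some positive $n\equiv0\pmod 8$, $C$ is $d_n^+$ or a Type II neighbor of $d_n^+$. These are graded by degree; for such a ring $R$, $R_{\le 24}$ denotes the direct sum of its homogeneous components of degree at most $24$. *)

(* Defs.v *)
From mathcomp Require Import all_boot all_order all_algebra.
From mathcomp Require Import mpoly.
From mathcomp Require Import boolp classical_sets reals.
From mathcomp Require Import complex.
Set Implicit Arguments.
Unset Strict Implicit.
Unset Printing Implicit Defensive.
Import GRing.Theory.

Local Open Scope ring_scope.
Local Open Scope classical_set_scope.

Definition binary_code (n : nat) := {vspace 'rV['F_2]_n}.

Definition inner (n : nat) (u v : 'rV['F_2]_n) : 'F_2 :=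
  \sum_(i < n) u 0 i * v 0 i.

Definition dual_code (n : nat) (C : binary_code n) : {set 'rV['F_2]_n} :=
  [set u : 'rV['F_2]_n | [forall v in C, inner u v == 0]]%SET.

Definition self_dual (n : nat) (C : binary_code n) : Prop :=
  C =i dual_code C.

Definition weight (n : nat) (u : 'rV['F_2]_n) : nat :=
  #|[set i : 'I_n | u 0 i != 0]%SET|.

Definition typeII (n : nat) (C : binary_code n) : Prop :=
  self_dual C /\ (forall u, u \in C -> (4 %| weight u)%N).

(* "dim + 1 = n/2" avoids the truncated subtraction of [nat] at n = 0. *)
Definition neighbors (n : nat) (C D : binary_code n) : Prop :=
  [/\ self_dual C, self_dual D & (\dim (C :&: D)%VS + 1 = n %/ 2)%N].

(* Ordinals start at 0 and coordinates at 1: [j : 'I_n] is coordinate j.+1. *)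
Definition dplus_gen (n i : nat) : 'rV['F_2]_n :=
  \row_(j < n) (j.+1 \in [:: 1; 2; 2 * i - 1; 2 * i]%N)%:R.

Definition dplus_glue (n : nat) : 'rV['F_2]_n :=
  \row_(j < n) (odd j.+1)%:R.

(* Defined for every n, but only used for n > 0 divisible by 8. *)
Definition dplus (n : nat) : binary_code n :=
  <<dplus_glue n :: [seq dplus_gen n i | i <- index_iota 2 (n %/ 2).+1]>>%VS.

(* K[x_a : a in F_2^g]; x_a is the variable whose index is the rank of a. *)
Definition wpoly (K : fieldType) (g : nat) := {mpoly K[#|{: 'cV['F_2]_g}|]}.

Definition wvar (K : fieldType) (g : nat) (a : 'cV['F_2]_g) : wpoly K g :=
  'X_(enum_rank a).

Definition col_count (n g : nat) (u : {ffun 'I_g -> 'rV['F_2]_n})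
    (a : 'cV['F_2]_g) : nat :=
  #|[set i : 'I_n | \col_(k < g) u k 0 i == a]%SET|.

Definition weight_enum (K : fieldType) (g n : nat) (C : binary_code n) :
    wpoly K g :=
  \sum_(u : {ffun 'I_g -> 'rV['F_2]_n} | [forall k, u k \in C])
    \prod_(a : 'cV['F_2]_g) wvar K a ^+ col_count u a.

Inductive subalg_gen (K : fieldType) (A : algType K) (S : set A) : set A :=
  | subalg_gen_in x : S x -> subalg_gen S x
  | subalg_gen1 : subalg_gen S 1
  | subalg_genD x y : subalg_gen S x -> subalg_gen S y -> subalg_gen S (x + y)
  | subalg_genZ (c : K) x : subalg_gen S x -> subalg_gen S (c *: x)
  | subalg_genM x y : subalg_gen S x -> subalg_gen S y -> subalg_gen S (x * y).

Definition ringB (K : fieldType) (g : nat) : set (wpoly K g) :=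
  subalg_gen [set p : wpoly K g |
    exists (n : nat) (C : binary_code n), typeII C /\ p = weight_enum K g C].

Definition ringD (K : fieldType) (g : nat) : set (wpoly K g) :=
  subalg_gen [set p : wpoly K g |
    exists n : nat, [/\ (0 < n)%N, (8 %| n)%N & p = weight_enum K g (dplus n)]].

Definition ringA (K : fieldType) (g : nat) : set (wpoly K g) :=
  subalg_gen [set p : wpoly K g |
    exists (n : nat) (C : binary_code n),
      [/\ (0 < n)%N, (8 %| n)%N,
          C = dplus n \/ (typeII C /\ neighbors C (dplus n))
        & p = weight_enum K g C]].

Arguments ringB K g : clear implicits.
Arguments ringD K g : clear implicits.
Arguments ringA K g : clear implicits.

Definition homog_comp (K : fieldType) (m : nat) (S : set {mpoly K[m]})
    (d : nat) : set {mpoly K[m]} :=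
  [set p | S p /\ p \is d.-homog].

(* The sum of the homogeneous components of degree at most N. *)
Definition degree_le (K : fieldType) (m : nat) (S : set {mpoly K[m]})
    (N : nat) : set {mpoly K[m]} :=
  [set p | exists q : 'I_N.+1 -> {mpoly K[m]},
     (forall d : 'I_N.+1, homog_comp S d (q d)) /\ p = \sum_(d < N.+1) q d].

(* Main.v *)
Require Import Defs.
From mathcomp Require Import all_boot all_order all_algebra.
From mathcomp Require Import fingroup perm.
From mathcomp Require Import mpoly ssrcomplements.
From mathcomp Require Import boolp classical_sets reals.
From mathcomp Require Import complex.
From mathcomp Require Import zify ring.

(** The three rings are told apart by counting words of weight 4.

    Let Q be the set of weight-4 words of a Type II code C of length n. For
    a function f of four integers, [triple_sum] adds up, over the ordered
    triples (x, y, z) of Q,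
      f (|x /\ y|, |x /\ z|, |y /\ z|, |x /\ y /\ z|),
    which is a combination of coefficients of the genus-3 weight enumerator
    W_C. The functions f in use vanish unless the three supports meet
    pairwise, and then triple_sum is additive: read off a product of weight
    enumerators, that is, off the weight enumerator of a direct sum of
    codes, it only sees triples that live in a single summand, because the
    columns of a word of weight 4 cannot be shared out between two doubly
    even words unless one of them gets all. So if triple_sum f = mu * n for
    every generator of an algebra, the same relation holds in all of it: in
    algebraic terms, the functional that measures the failure of this
    relation is a derivation over the ring homomorphism which extracts the
    pure powers of the variable x_0 (lemmas [triple_weightD],
    [balanced_subalg]). Only generators of degree at most 24 matter in
    degree 24. A code of length 24 that violates the relation therefore has
    its weight enumerator outside of the algebra
    ([weight_enum_notin_subalg]).

    The constants come from the following picture. In each code that occurs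
    below, every coordinate lies in the same number eta of weight-4 words.
    Then Q has n eta / 4 elements and n eta (eta - 1) / 2 ordered pairs that
    meet in two points; and if S and T are the numbers of ordered triples
    that meet pairwise in two points and all together in two points,
    respectively in one point, then 2 S + T = n eta (eta - 1) (eta - 2).
    With these values the two functions [weightD] and [weightA] satisfy
      triple_sum weightD - 77 n = - n (eta - 7) (eta - 11),
      triple_sum weightA - 385 n = n (eta - 5) (eta - 7) (eta - 11).
    For d_8^+, d_16^+, d_24^+ the number eta is 7, 7, 11. The Type II
    neighbors of these are equivalent to d_8^+; d_16^+ and d_8^+ + d_8^+
    (both with eta = 7); d_24^+, d_16^+ + d_8^+ (eta = 7) and a code with
    components d_12, d_12 (eta = 5). The last one separates ringD from
    ringA. One of its neighbors has components d_8, d_8, d_8 (eta = 3) and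
    separates ringA from ringB.

    That every neighbor C of D = d_n^+ satisfies the relation for weightA is
    reduced to a finite check: C consists of the u orthogonal to some v with
    u or u + v in D ([neighbor_of]), and permutations of the blocks {2i-1,
    2i} together with translations by words of D bring v to one of a few
    normal forms ([sort_pairsums], [reduce_to_canon]). For these the
    weight-4 words are listed and the sum evaluated. *)

Set Implicit Arguments.
Unset Strict Implicit.
Unset Printing Implicit Defensive.
Import Order.TTheory GRing.Theory Num.Theory.

Local Open Scope ring_scope.
Local Open Scope classical_set_scope.

(** * Linear functionals on polynomials *)

Section LinearExtension.
Variables (K : fieldType) (n : nat) (V : lmodType K).
Implicit Types (w : 'X_{1..n} -> V) (p q : {mpoly K[n]}).

(** The linear extension of [w] from monomials to polynomials. *)
Definition mlin w p : V := \sum_(m <- msupp p) p@_m *: w m.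

Lemma mlin_bounded w p (b : nat) : (msize p <= b)%N ->
  mlin w p = \sum_(m : 'X_{1..n < b}) p@_m *: w m.
Proof.
move=> le_pb; pose I : subFinType _ := 'X_{1..n < b}.
rewrite /mlin (big_mksub I) //=; first last.
- by move=> m /msize_mdeg_lt /leq_trans; apply.
- by rewrite msupp_uniq.
by rewrite big_rmcond //= => m /memN_msupp_eq0 ->; rewrite scale0r.
Qed.

Lemma mlinD w p q : mlin w (p + q) = mlin w p + mlin w q.
Proof.
pose b := maxn (msize (p + q)) (maxn (msize p) (msize q)).
rewrite !(@mlin_bounded w _ b); do ?by rewrite /b; lia.
by rewrite -big_split; apply: eq_bigr => m _; rewrite mcoeffD scalerDl.
Qed.

Lemma mlinZ w c p : mlin w (c *: p) = c *: mlin w p.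
Proof.
pose b := maxn (msize (c *: p)) (msize p).
rewrite !(@mlin_bounded w _ b); do ?by rewrite /b; lia.
by rewrite scaler_sumr; apply: eq_bigr => m _; rewrite mcoeffZ scalerA.
Qed.

Lemma mlin0 w : mlin w 0 = 0.
Proof. by rewrite /mlin big1_seq // => m _; rewrite mcoeff0 scale0r. Qed.

Lemma mlin_sum w (I : Type) (r : seq I) (P : pred I) (F : I -> {mpoly K[n]}) :
  mlin w (\sum_(i <- r | P i) F i) = \sum_(i <- r | P i) mlin w (F i).
Proof. exact: (big_morph _ (mlinD w) (mlin0 w)). Qed.

Lemma mlinX w m : mlin w 'X_[m] = w m.
Proof. by rewrite /mlin msuppX big_seq1 mcoeffX eqxx scale1r. Qed.

Lemma mlinM w p q : mlin w (p * q) =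
  \sum_(m <- msupp p) \sum_(m' <- msupp q) (p@_m * q@_m') *: w (m + m')%MM.
Proof.
rewrite {1}[p]mpolyE mulr_suml mlin_sum; apply: eq_bigr => m _.
rewrite {1}[q]mpolyE mulr_sumr mlin_sum; apply: eq_bigr => m' _.
by rewrite -scalerAl -scalerAr scalerA mlinZ -mpolyXD mlinX.
Qed.

End LinearExtension.

(** A functional that obeys the Leibniz rule on certain monomials obeys it on
    all polynomials made of such monomials, by bilinearity. *)
Lemma mlin_derivation (K : fieldType) (n : nat) (good : pred 'X_{1..n})
    (w w0 : 'X_{1..n} -> {poly K}) (p q : {mpoly K[n]}) :
  (forall m m', good m -> good m' ->
     w (m + m')%MM = w m * w0 m' + w0 m * w m') ->
  all good (msupp p) -> all good (msupp q) ->
  mlin w (p * q) = mlin w p * mlin w0 q + mlin w0 p * mlin w q.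
Proof.
move=> wM /allP gp /allP gq; rewrite mlinM /mlin !mulr_suml -big_split /=.
apply: eq_big_seq => m /gp gm; rewrite !mulr_sumr -big_split /=.
apply: eq_big_seq => m' /gq gm'; rewrite wM // scalerDr.
by rewrite -!scalerAl -!scalerAr !scalerA.
Qed.

(** * Triples of weight-4 words as a derivation *)

Notation column := 'cV['F_2]_3.
Notation monomial := ('X_{1..#|{: column}|}).

(** For the monomial of a triple of words this is the number of coordinates
    whose column satisfies [P]; with [row_on i] it is the weight of the i-th
    word, with a conjunction of these the size of an intersection. *)
Definition hits (P : pred column) (m : monomial) : nat :=
  \sum_(a | P a) m (enum_rank a).

Lemma hitsD P m m' : hits P (m + m')%MM = (hits P m + hits P m')%N.
Proof. by rewrite /hits -big_split; apply: eq_bigr => a _; rewrite mnmDE. Qed.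

Lemma hits_sub (P P' : pred column) m :
  (forall a, P a -> P' a) -> (hits P m <= hits P' m)%N.
Proof.
move=> sPP'; rewrite /hits big_mkcond [X in (_ <= X)%N]big_mkcond /=.
by apply: leq_sum => a _; case: ifP => // /sPP' ->.
Qed.

Lemma hits_predI0 (P P' : pred column) m :
  hits P m = 0%N -> hits (predI P P') m = 0%N.
Proof.
move=> P0; apply/eqP; rewrite -leqn0 -[X in (_ <= X)%N]P0.
by apply: hits_sub => a /andP[].
Qed.

Lemma hits0 P : hits P 0%MM = 0%N.
Proof. by rewrite /hits big1 // => a _; rewrite mnm0E. Qed.

Definition r0 : 'I_3 := @Ordinal 3 0 isT.
Definition r1 : 'I_3 := @Ordinal 3 1 isT.
Definition r2 : 'I_3 := @Ordinal 3 2 isT.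

Definition row_on (i : 'I_3) : pred column := fun a => a i 0 != 0.

(** The value of [f] on the intersections of a triple of weight-4 words, in a
    form that makes sense for any monomial. *)
Definition triple_weight (f : nat -> nat -> nat -> nat -> int)
    (m : monomial) : int :=
  if [forall i, hits (row_on i) m == 4] then
    f (hits (predI (row_on r0) (row_on r1)) m)
      (hits (predI (row_on r0) (row_on r2)) m)
      (hits (predI (row_on r1) (row_on r2)) m)
      (hits (predI (predI (row_on r0) (row_on r1)) (row_on r2)) m)
  else 0.

(** The monomials x_0 ^ d, which come from the triple (0, 0, 0). *)
Definition null m := [forall i, hits (row_on i) m == 0%N].

Definition doubly_even m := [forall i, 4 %| hits (row_on i) m]%N.

(** Triples that count are those whose supports meet pairwise, so that they
    cannot be spread over two summands of a direct sum of codes. *)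
Definition connected (f : nat -> nat -> nat -> nat -> int) :=
  forall i j k l, [|| i == 0%N, j == 0%N | k == 0%N] -> f i j k l = 0.

Lemma forall_I3 (P : pred 'I_3) : [forall i, P i] = [&& P r0, P r1 & P r2].
Proof.
apply/forallP/and3P => [h|[h0 h1 h2] i]; first by split; apply: h.
by case: i => [[|[|[|//]]] ilt]; rewrite (bool_irrelevance ilt isT).
Qed.

Lemma nullD m m' : null (m + m')%MM = null m && null m'.
Proof. by rewrite /null !forall_I3 !hitsD; lia. Qed.

(** The rows of [m] and [m'] have weights 0 or 4 when those of their product
    have weight 4.  If neither monomial is null, some row i lies in [m] and
    another row j in [m'], so rows i and j do not meet and [f] vanishes. *)
Lemma triple_weightD f m m' :
  connected f -> doubly_even m -> doubly_even m' ->
  triple_weight f (m + m')%MM =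
    triple_weight f m * (null m')%:R + (null m)%:R * triple_weight f m'.
Proof.
move=> fc; rewrite /doubly_even !forall_I3 => gm gm'.
rewrite /triple_weight /null !forall_I3 !hitsD.
have [m0|m_n0] := boolP [&& hits (row_on r0) m == 0%N,
    hits (row_on r1) m == 0%N & hits (row_on r2) m == 0%N].
  case/and3P: m0 => /eqP h0 /eqP h1 /eqP h2.
  rewrite h0 h1 h2 !(@hits_predI0 _ _ m) ?h0 ?h1 //=.
  by rewrite mul0r mul1r !add0r !add0n.
have [m'0|m'_n0] := boolP [&& hits (row_on r0) m' == 0%N,
    hits (row_on r1) m' == 0%N & hits (row_on r2) m' == 0%N].
  case/and3P: m'0 => /eqP h0 /eqP h1 /eqP h2.
  rewrite h0 h1 h2 !(@hits_predI0 _ _ m') ?h0 ?h1 //=.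
  by rewrite mulr0 mulr1 !addn0 addr0.
rewrite mulr0 mul0r addr0; case: ifP => // eq4; apply: fc.
pose h i j k := hits (predI (row_on i) (row_on j)) k.
have le k i j : (h i j k <= hits (row_on i) k)%N /\
                (h i j k <= hits (row_on j) k)%N.
  by split; apply: hits_sub => a /andP[].
have [[[? ?] [? ?]] [? ?]] := (le m r0 r1, le m r0 r2, le m r1 r2).
have [[[? ?] [? ?]] [? ?]] := (le m' r0 r1, le m' r0 r2, le m' r1 r2).
by unfold h in *; lia.
Qed.

Section BalancedPolynomials.
Variables (K : fieldType) (f : nat -> nat -> nat -> nat -> int) (mu : int).
Hypothesis f_connected : connected f.

(** The variable of {poly K} records the degree, which is the length of the
    code: [mlin excess] applied to the weight enumerator of a code of length n
    is (triple_sum f - mu n) 'X^n. *)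
Definition excess (m : monomial) : {poly K} :=
  (triple_weight f m - mu * (mdeg m)%:Z * (null m)%:R)%:~R *: 'X^(mdeg m).

Definition null_part (m : monomial) : {poly K} :=
  (null m)%:R *: 'X^(mdeg m).

(** Both terms of the excess are derivations over [null_part]: the first by
    [triple_weightD], the second because the degree is additive. *)
Lemma excessD m m' : doubly_even m -> doubly_even m' ->
  excess (m + m')%MM = excess m * null_part m' + null_part m * excess m'.
Proof.
move=> gm gm'; rewrite /excess /null_part triple_weightD // nullD mdegD.
rewrite -!scalerAl -!scalerAr -exprD !scalerA -scalerDl; congr (_ *: _).
rewrite PoszD !(rmorphD, rmorphB, rmorphM, rmorph_nat) /=.
by case: (null m); case: (null m'); rewrite /=; ring.
Qed.

(** Working modulo 'X^25 leaves the generators of degree above 24 free. *)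
Definition balanced (p : wpoly K 3) :=
  all doubly_even (msupp p) /\ exists r, mlin excess p = 'X^25 * r.

Lemma doubly_evenD m m' :
  doubly_even m -> doubly_even m' -> doubly_even (m + m')%MM.
Proof.
by move=> /forallP g /forallP g'; apply/forallP=> i; rewrite hitsD dvdn_add.
Qed.

Lemma balanced_subalg (S : set (wpoly K 3)) :
  (forall p, S p -> balanced p) -> forall p, subalg_gen S p -> balanced p.
Proof.
move=> Sb p; elim=> {p} [p /Sb //| | p q _ [gp [r Er]] _ [gq [s Es]]
  | c p _ [gp [r Er]] | p q _ [gp [r Er]] _ [gq [s Es]]].
- split.
    rewrite -[X in msupp X]mpolyX0 msuppX /= andbT.
    by apply/forallP=> i; rewrite hits0.
  exists 0; rewrite -mpolyX0 mlinX mulr0 /excess mdeg0 mulr0 mul0r subr0.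
  by rewrite /triple_weight forall_I3 !hits0 scale0r.
- split.
    apply/allP=> m /msuppD_le; rewrite mem_cat.
    by case/orP=> [/(allP gp)|/(allP gq)].
  by exists (r + s); rewrite mlinD Er Es mulrDr.
- split; first by apply/allP=> m /msuppZ_le /(allP gp).
  by exists (c *: r); rewrite mlinZ Er scalerAr.
- split.
    apply/allP=> m /msuppM_le /allpairsP[[m1 m2] /= [m1p m2q ->]].
    by apply: doubly_evenD; [apply: (allP gp) | apply: (allP gq)].
  exists (r * mlin null_part q + mlin null_part p * s).
  rewrite (mlin_derivation excessD gp gq) Er Es.
  by rewrite mulrDr mulrA mulrCA.
Qed.

End BalancedPolynomials.

(** * Weight enumerators in genus 3 *)

Definition supp (n : nat) (u : 'rV['F_2]_n) : {set 'I_n} :=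
  [set i | u 0 i != 0]%SET.

Notation word_triple n := {ffun 'I_3 -> 'rV['F_2]_n}.

Definition column_at (n : nat) (u : word_triple n) (i : 'I_n) : column :=
  \col_(k < 3) u k 0 i.

Definition column_monomial (n : nat) (u : word_triple n) : monomial :=
  [multinom col_count u (enum_val i) | i < #|{: column}|].

Lemma column_monomialE n (u : word_triple n) a :
  column_monomial u (enum_rank a) = col_count u a.
Proof. by rewrite mnmE enum_rankK. Qed.

(** The product over all columns in the definition is a single monomial. *)
Lemma weight_enumE (K : fieldType) n (C : binary_code n) :
  weight_enum K 3 C =
  \sum_(u : word_triple n | [forall k, u k \in C]) 'X_[column_monomial u].
Proof.
apply: eq_bigr => u _; rewrite mpolyXE_id (reindex_onto enum_rank enum_val) /=;
  last by move=> i _; rewrite enum_valK.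
under [RHS]eq_bigl => a do rewrite enum_rankK eqxx.
by apply: eq_bigr => a _; rewrite column_monomialE.
Qed.

Lemma hits_column_monomial n (u : word_triple n) (P : pred column) :
  hits P (column_monomial u) = #|[set i | P (column_at u i)]%SET|.
Proof.
rewrite /hits; under eq_bigr => a _ do rewrite column_monomialE /col_count.
rewrite -sum1_card (partition_big (column_at u) P) /=; last first.
  by move=> i; rewrite inE.
apply: eq_bigr => a Pa; rewrite -sum1_card; apply: eq_bigl => i.
by rewrite !inE /column_at; case: eqP => [->|]; rewrite ?Pa ?andbF.
Qed.

Lemma mdeg_column_monomial n (u : word_triple n) :
  mdeg (column_monomial u) = n.
Proof.
transitivity (hits predT (column_monomial u)); last first.
  by rewrite hits_column_monomial cardsE cardT size_enum_ord.
rewrite mdegE /hits (reindex_onto enum_rank enum_val) /=;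
  last by move=> i _; rewrite enum_valK.
by apply: eq_bigl => a; rewrite enum_rankK eqxx.
Qed.

Lemma hits_row n (u : word_triple n) k :
  hits (row_on k) (column_monomial u) = weight (u k).
Proof.
rewrite hits_column_monomial; apply: eq_card => i.
by rewrite !inE /row_on mxE.
Qed.

Lemma weight_eq0 n (u : 'rV['F_2]_n) : (weight u == 0%N) = (u == 0).
Proof.
rewrite cards_eq0; apply/eqP/eqP => [u0|->].
  apply/rowP=> i; have /setP/(_ i) := u0.
  by rewrite !inE mxE => /negbFE/eqP.
by apply/setP=> i; rewrite !inE mxE eqxx.
Qed.

Definition triple_sum (f : nat -> nat -> nat -> nat -> int) n
    (C : pred 'rV['F_2]_n) : int :=
  \sum_(x | C x && (weight x == 4%N)) \sum_(y | C y && (weight y == 4%N))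
    \sum_(z | C z && (weight z == 4%N))
      f #|supp x :&: supp y|%SET #|supp x :&: supp z|%SET
        #|supp y :&: supp z|%SET #|supp x :&: supp y :&: supp z|%SET.

Lemma triple_weight_column_monomial f n (u : word_triple n) :
  triple_weight f (column_monomial u) =
  if [forall k, weight (u k) == 4%N] then
    f #|supp (u r0) :&: supp (u r1)|%SET #|supp (u r0) :&: supp (u r2)|%SET
      #|supp (u r1) :&: supp (u r2)|%SET
      #|supp (u r0) :&: supp (u r1) :&: supp (u r2)|%SET
  else 0.
Proof.
rewrite /triple_weight !forall_I3 !hits_row !hits_column_monomial.
have e (A B : {set 'I_n}) : A =i B -> #|A| = #|B| by apply: eq_card.
case: ifP => // _; congr f; apply: e => i; by rewrite !inE /row_on !mxE.
Qed.

Definition triple n (x y z : 'rV['F_2]_n) : word_triple n :=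
  [ffun k => tnth [tuple x; y; z] k].

Lemma sum_word_triple n (P : pred 'rV['F_2]_n) (F : word_triple n -> int) :
  \sum_(u : word_triple n | [forall k, P (u k)]) F u =
  \sum_(x | P x) \sum_(y | P y) \sum_(z | P z) F (triple x y z).
Proof.
under [RHS]eq_bigr => x _ do rewrite pair_big /=.
rewrite pair_big /=.
rewrite (reindex (fun p => triple p.1 p.2.1 p.2.2)) /=; last first.
  exists (fun u : word_triple n => (u r0, (u r1, u r2))) => [[x [y z]]|u] _.
    by rewrite /= !ffunE.
  apply/ffunP=> k; rewrite ffunE.
  by case: k => [[|[|[|//]]] klt]; rewrite (bool_irrelevance klt isT).
by apply: eq_bigl => [[x [y z]]]; rewrite forall_I3 !ffunE.
Qed.

(** The triple sum is read off the monomials of the weight enumerator. *)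
Lemma triple_sumE f n (C : pred 'rV['F_2]_n) :
  triple_sum f C =
  \sum_(u : word_triple n | [forall k, C (u k)])
     triple_weight f (column_monomial u).
Proof.
under eq_bigr => u _ do rewrite triple_weight_column_monomial.
rewrite -big_mkcondr /=.
rewrite (eq_bigl (fun u : word_triple n =>
  [forall k, C (u k) && (weight (u k) == 4%N)])); last first.
  move=> u; rewrite !forall_I3.
  by case: (C (u r0)); case: (C (u r1)); case: (C (u r2)); rewrite /= ?andbF.
rewrite (sum_word_triple (fun x => C x && (weight x == 4%N))).
by do 3![apply: eq_bigr => ? _]; rewrite !ffunE.
Qed.

Lemma null_column_monomial n (u : word_triple n) :
  null (column_monomial u) = (u == [ffun=> 0]).
Proof.
rewrite /null forall_I3 !hits_row !weight_eq0.
apply/and3P/eqP => [[/eqP u0 /eqP u1 /eqP u2]|->]; last by rewrite !ffunE.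
apply/ffunP=> k; rewrite ffunE.
by case: k => [[|[|[|//]]] klt]; rewrite (bool_irrelevance klt isT).
Qed.

Lemma mlin_excess_weight_enum (K : fieldType) f mu n (C : binary_code n) :
  mlin (excess K f mu) (weight_enum K 3 C) =
  (triple_sum f (mem C) - mu * n%:Z)%:~R *: 'X^n.
Proof.
rewrite weight_enumE mlin_sum.
under eq_bigr => u _ do rewrite mlinX /excess mdeg_column_monomial.
rewrite -scaler_suml -rmorph_sum /= triple_sumE big_split /= sumrN.
congr ((_ - _)%:~R *: _); rewrite -mulr_sumr.
rewrite (bigD1 [ffun=> 0]) /=; last by apply/forallP=> k; rewrite ffunE mem0v.
rewrite null_column_monomial eqxx big1 ?addr0 ?mulr1 // => u /andP[_ /negPf u0].
by rewrite null_column_monomial u0.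
Qed.

Lemma doubly_even_weight_enum (K : fieldType) n (C : binary_code n) :
  typeII C -> all doubly_even (msupp (weight_enum K 3 C)).
Proof.
move=> [_ C4]; apply/allP=> m; rewrite weight_enumE => /msupp_sum_le.
case/flattenP=> s /mapP[u]; rewrite mem_filter => /andP[/forallP uC _] ->.
rewrite msuppX inE => /eqP->; apply/forallP=> k.
by rewrite hits_row C4 ?uC.
Qed.

Lemma balanced_weight_enum (K : fieldType) f mu n (C : binary_code n) :
  typeII C ->
  ((n <= 24)%N -> triple_sum f (mem C) = mu * n%:Z) ->
  balanced f mu (weight_enum K 3 C).
Proof.
move=> C2 Cf; split; first exact: doubly_even_weight_enum.
rewrite mlin_excess_weight_enum; have [/Cf ->|n_gt] := leqP n 24.
  by exists 0; rewrite subrr mulr0 scale0r.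
exists ((triple_sum f (mem C) - mu * n%:Z)%:~R *: 'X^(n - 25)).
by rewrite -scalerAr -exprD subnKC.
Qed.

Lemma balanced_triple_sum (K : numFieldType) f mu (C : binary_code 24) :
  balanced f mu (weight_enum K 3 C) -> triple_sum f (mem C) = mu * 24.
Proof.
case=> _ [r]; rewrite mlin_excess_weight_enum.
move/(congr1 (fun p : {poly K} => p`_24)).
rewrite coefZ coefXn eqxx mulr1 coefXnM /= => /eqP.
by rewrite intr_eq0 subr_eq0 => /eqP.
Qed.

(** If the weight enumerator of C lies in the algebra it is balanced, and the
    coefficient of 'X^24 in its excess, an integer, vanishes in K. *)
Lemma weight_enum_notin_subalg (K : numFieldType) f mu
    (F : forall n, binary_code n -> Prop) (C : binary_code 24) :
  connected f ->
  (forall n (D : binary_code n), F n D -> typeII D) ->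
  (forall n (D : binary_code n), F n D -> (n <= 24)%N ->
     triple_sum f (mem D) = mu * n%:Z) ->
  triple_sum f (mem C) <> mu * 24 ->
  ~ subalg_gen [set p : wpoly K 3 |
      exists n (D : binary_code n), F n D /\ p = weight_enum K 3 D]
    (weight_enum K 3 C).
Proof.
move=> fc F2 Ff Cf /(balanced_subalg (mu := mu) fc) bal; apply: Cf.
apply: (@balanced_triple_sum K); apply: bal => _ [n [D [FD ->]]].
by apply: balanced_weight_enum => [|n_le]; [apply: F2 FD | apply: Ff].
Qed.

(** * Self-dual codes and their neighbors *)

Section InnerProduct.
Variable n : nat.
Implicit Types u v w : 'rV['F_2]_n.

Lemma F2_cases (x : 'F_2) : (x = 0) \/ (x = 1).
Proof. by case: x => [[|[|//]] ?]; [left|right]; apply: val_inj. Qed.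

Lemma addFF (x : 'F_2) : x + x = 0.
Proof. by case: (F2_cases x) => ->; apply: val_inj. Qed.

Lemma addF_eq0 (x y : 'F_2) : x + y = 0 -> x = y.
Proof. by case: (F2_cases x) => ->; case: (F2_cases y) => ->. Qed.

Lemma F2_neq0 (x : 'F_2) : (x != 0) = (x == 1).
Proof. by case: (F2_cases x) => ->. Qed.

Lemma addvv u : u + u = 0.
Proof. by apply/rowP=> i; rewrite !mxE addFF. Qed.

Lemma innerC u v : inner u v = inner v u.
Proof. by apply: eq_bigr => i _; rewrite mulrC. Qed.

Lemma innerDl u v w : inner (u + v) w = inner u w + inner v w.
Proof. by rewrite -big_split; apply: eq_bigr => i _; rewrite mxE mulrDl. Qed.

Lemma innerDr u v w : inner w (u + v) = inner w u + inner w v.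
Proof. by rewrite !(innerC w) innerDl. Qed.

Lemma innerZl c u w : inner (c *: u) w = c * inner u w.
Proof. by rewrite mulr_sumr; apply: eq_bigr => i _; rewrite mxE mulrA. Qed.

Lemma inner0l w : inner 0 w = 0.
Proof. by rewrite -(scale0r 0) innerZl mul0r. Qed.

Lemma inner_parity u v : inner u v = #|supp u :&: supp v|%SET%:R.
Proof.
rewrite /inner -sum1_card natr_sum big_mkcond [RHS]big_mkcond /=.
apply: eq_bigr => i _; rewrite !inE.
case: (F2_cases (u 0 i)) => ->; case: (F2_cases (v 0 i)) => ->;
  by rewrite /= ?mulr0 ?mul0r ?mulr1.
Qed.

Lemma natF2_eq0 k : (k%:R == 0 :> 'F_2) = ~~ odd k.
Proof. by rewrite -dvdn2 (dvdn_pcharf (pchar_Fp _)). Qed.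

Lemma inner_eq0 u v : (inner u v == 0) = ~~ odd #|supp u :&: supp v|%SET.
Proof. by rewrite inner_parity natF2_eq0. Qed.

Lemma inner_self u : (inner u u == 0) = ~~ odd (weight u).
Proof. by rewrite inner_eq0 finset.setIid. Qed.

Lemma weight_add u v :
  (weight (u + v) + 2 * #|supp u :&: supp v|%SET = weight u + weight v)%N.
Proof.
have sD : supp (u + v) = (supp u :\: supp v :|: supp v :\: supp u)%SET.
  apply/setP=> i; rewrite !inE !mxE.
  by case: (F2_cases (u 0 i)) => ->; case: (F2_cases (v 0 i)) => ->.
rewrite -[weight (u + v)]/#|supp (u + v)| sD cardsU.
rewrite (_ : (_ :&: _)%SET = finset.set0) ?cards0; last first.
  by apply/setP=> i; rewrite !inE; case: (_ != 0); case: (_ != 0).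
rewrite -[weight u]/#|supp u| -[weight v]/#|supp v|.
have := cardsID (supp v) (supp u); have := cardsID (supp u) (supp v).
by rewrite (finset.setIC (supp v)); lia.
Qed.

Lemma weight_add_dvd4 u v : (4 %| weight u)%N -> (4 %| weight v)%N ->
  inner u v = 0 -> (4 %| weight (u + v))%N.
Proof.
move=> u4 v4 /eqP; rewrite inner_eq0 => uv; have := weight_add u v.
have : (2 %| #|supp u :&: supp v|%SET)%N by rewrite dvdn2.
by move: u4 v4; lia.
Qed.

End InnerProduct.

Lemma dual_codeP n (C : binary_code n) u :
  reflect (forall v, v \in C -> inner u v = 0) (u \in dual_code C).
Proof.
rewrite inE; apply: (iffP forallP) => [h v vC|h v].
  by have /implyP/(_ vC)/eqP := h v.
by apply/implyP=> /h ->.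
Qed.

Lemma self_dual_inner n (C : binary_code n) u v :
  self_dual C -> u \in C -> v \in C -> inner u v = 0.
Proof. by move=> sC; rewrite sC => /dual_codeP; apply. Qed.

Lemma self_dual_mem n (C : binary_code n) u :
  self_dual C -> (forall v, v \in C -> inner u v = 0) -> u \in C.
Proof. by move=> sC uC; rewrite sC; apply/dual_codeP. Qed.

Definition hyperplane n (v : 'rV['F_2]_n) : {vspace 'rV['F_2]_n} :=
  lker (linfun (mulmxr v^T)).

Lemma mem_hyperplane n (u v : 'rV['F_2]_n) :
  (u \in hyperplane v) = (inner u v == 0).
Proof.
rewrite memv_ker lfunE /=; apply/eqP/eqP => [/matrixP/(_ 0 0)|uv].
  rewrite !mxE => uv; rewrite -[RHS]uv.
  by apply: eq_bigr => i _; rewrite mxE.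
apply/matrixP=> i j; rewrite !mxE -[RHS]uv; apply: eq_bigr => k _.
by rewrite mxE !ord1.
Qed.

(** Kneser's construction of a neighbor of [D]. *)
Definition nbr n (D : binary_code n) (v : 'rV['F_2]_n) : binary_code n :=
  (D :&: hyperplane v + <[v]>)%VS.

Definition nbr_mem n (D : binary_code n) v u :=
  (inner u v == 0) && ((u \in D) || (u + v \in D)).

Lemma mem_nbr n (D : binary_code n) v u : inner v v = 0 ->
  (u \in nbr D v) = nbr_mem D v u.
Proof.
move=> vv; apply/memv_addP/andP => [[h + [w + ->]]|[uv uD]].
  rewrite memv_cap mem_hyperplane => /andP[hD /eqP hv] /vlineP[c ->].
  rewrite innerDl innerZl vv mulr0 addr0 hv; split=> //.
  case: (F2_cases c) => ->; first by rewrite scale0r addr0 hD.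
  by rewrite scale1r -addrA addvv addr0 hD orbT.
case: (boolP (u \in D)) uD => [uD _|_ /= uvD].
  exists u; first by rewrite memv_cap mem_hyperplane uD uv.
  by exists 0; rewrite ?mem0v ?addr0.
exists (u + v); first by rewrite memv_cap mem_hyperplane uvD innerDl vv addr0.
by exists v; rewrite ?memv_line // -addrA addvv addr0.
Qed.

(** A word u orthogonal to [nbr D v] is orthogonal to v and to the hyperplane
    of D that v cuts out.  If d in D is off this hyperplane, u or u + v is also
    orthogonal to d, hence to all of D, according to the value of (u, d). *)
Lemma nbr_typeII n (D : binary_code n) v :
  typeII D -> v \notin D -> (4 %| weight v)%N -> typeII (nbr D v).
Proof.
move=> [sD D4] vD v4.
have vv : inner v v = 0.
  by apply/eqP; rewrite inner_self -dvdn2 (dvdn_trans _ v4).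
have DD := self_dual_inner sD.
split=> [u|u]; last first.
  rewrite mem_nbr // => /andP[/eqP uv /orP[/D4 //|/D4 uv4]].
  rewrite -[u](addr0) -(addvv v) addrA; apply: weight_add_dvd4 => //.
  by rewrite innerDl uv vv addr0.
rewrite mem_nbr //; apply/idP/dual_codeP => [/andP[/eqP uv uD] w|uC].
  rewrite mem_nbr // => /andP[/eqP wv wD].
  have e1 : inner (u + v) (w + v) = inner u w.
    by rewrite !(innerDl, innerDr) uv vv (innerC v) wv !addr0.
  have e2 : inner (u + v) w = inner u w by rewrite innerDl (innerC v) wv addr0.
  have e3 : inner u (w + v) = inner u w by rewrite innerDr uv addr0.
  by case/orP: uD => uD; case/orP: wD => wD;
     move: (DD _ _ uD wD); rewrite ?e1 ?e2 ?e3.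
have uv : inner u v = 0.
  by apply: uC; rewrite mem_nbr // /nbr_mem vv eqxx addvv mem0v orbT.
rewrite /nbr_mem uv eqxx /=.
have uDv w : w \in D -> inner w v = 0 -> inner u w = 0.
  by move=> wD wv; apply: uC; rewrite mem_nbr // /nbr_mem wv eqxx wD.
(* v is not orthogonal to D = D^perp *)
have [d dD dv] : exists2 d, d \in D & inner d v = 1.
  have : ~~ (v \in dual_code D) by rewrite -sD.
  rewrite inE => /forallPn[d]; rewrite negb_imply => /andP[dD].
  by rewrite F2_neq0 innerC => /eqP; exists d.
have split_d x : (forall w, w \in D -> inner w v = 0 -> inner x w = 0) ->
    inner x d = 0 -> x \in D.
  move=> xH xd; apply: self_dual_mem => // w wD.
  case: (F2_cases (inner w v)) => wv; first exact: xH.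
  rewrite -[w]addr0 -(addvv d) addrA innerDr xd addr0; apply: xH.
    exact: memvD.
  by rewrite innerDl wv dv addFF.
case: (F2_cases (inner u d)) => ud; first by rewrite split_d.
rewrite (split_d (u + v)) ?orbT //.
  by move=> w wD wv; rewrite innerDl uDv // innerC wv addr0.
by rewrite innerDl ud innerC dv addFF.
Qed.

Lemma nbr_neighbors n (D : binary_code n) v :
  typeII D -> v \notin D -> (4 %| weight v)%N -> \dim D = (n %/ 2)%N ->
  neighbors (nbr D v) D.
Proof.
move=> D2 vD v4 dimD; have [sD _] := D2.
have vv : inner v v = 0.
  by apply/eqP; rewrite inner_self -dvdn2 (dvdn_trans _ v4).
split=> //; first by case: (nbr_typeII D2 vD v4).
have -> : (nbr D v :&: D = D :&: hyperplane v)%VS.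
  apply/vspaceP=> u; rewrite !memv_cap mem_nbr // mem_hyperplane /nbr_mem.
  by rewrite andbC; case: (boolP (u \in D)) => //= _; rewrite andbT.
rewrite -dimD -(limg_ker_dim (linfun (mulmxr v^T)) D).
congr (_ + _)%N; apply/eqP; rewrite eqn_leq.
rewrite (leq_trans (dimvS (subvf _))) ?dimvf ?andbT /=;
  last by rewrite /dim /= muln1.
rewrite lt0n dimv_eq0; apply: contra vD => /eqP img0.
apply: self_dual_mem => // w wD; rewrite innerC; apply/eqP.
rewrite -mem_hyperplane memv_ker -memv0 -img0; exact: memv_img.
Qed.

(** A word v of C outside of D cuts D in the hyperplane C /\ D.  For another
    word u of C outside of D the forms (u, -) and (v, -) on D have this same
    kernel, so they agree, and u + v is orthogonal to D.  The case v = 0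
    stands for C = D. *)
Lemma neighbor_of n (C D : binary_code n) :
  neighbors C D -> (\dim D <= n %/ 2)%N ->
  exists2 v, inner v v = 0 & forall u, (u \in C) = nbr_mem D v u.
Proof.
move=> [sC sD dimCD] dimD.
have [CD|/subvPn[v vC vD]] := boolP (C <= D)%VS.
  have -> : C = D.
    apply/eqP; rewrite eqEsubv CD /=; apply/subvP=> u uD.
    apply: self_dual_mem => // w /(subvP CD) wD; exact: self_dual_inner sD uD wD.
  exists 0; rewrite ?inner0l // => u.
  by rewrite /nbr_mem innerC inner0l eqxx addr0 orbb.
have vv : inner v v = 0 by exact: (self_dual_inner sC vC vC).
exists v => //.
have capE : (C :&: D = D :&: hyperplane v)%VS.
  apply/eqP; rewrite eqEdim; apply/andP; split.
    apply/subvP=> u; rewrite !memv_cap mem_hyperplane => /andP[uC ->] /=.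
    by rewrite (self_dual_inner sC uC vC).
  suff : (\dim (D :&: hyperplane v) < \dim D)%N by lia.
  rewrite ltn_neqAle dimvS ?capvSl // andbT.
  apply: contra vD => dimE; apply: self_dual_mem => // w wD.
  have : (D :&: hyperplane v)%VS == D by rewrite eqEdim capvSl (eqP dimE) leqnn.
  move/eqP=> E; move: wD; rewrite -E memv_cap mem_hyperplane innerC.
  by case/andP=> _ /eqP.
have CH u : u \in D -> (u \in C) = (inner u v == 0).
  by move=> uD; rewrite -mem_hyperplane -[LHS]andbT -uD -memv_cap capE memv_cap uD.
move=> u; apply/idP/andP => [uC|[/eqP uv /orP[uD|uvD]]].
- split; first by rewrite (self_dual_inner sC uC vC).
  case: (boolP (u \in D)) => //= uD; apply: self_dual_mem => // w wD.
  have Hu x : x \in D -> inner x v = 0 -> inner x u = 0.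
    by move=> xD xv; apply: (self_dual_inner sC _ uC); rewrite CH ?xv.
  rewrite innerC innerDr; have [wv|wv] := F2_cases (inner w v).
    by rewrite Hu // wv addr0.
  have [wu|->] := F2_cases (inner w u); last by rewrite wv addFF.
  case/negP: uD; apply: self_dual_mem => // x xD; rewrite innerC.
  have [/(Hu _ xD)//|xv] := F2_cases (inner x v).
  have := Hu (x + w); rewrite !innerDl wu addr0; apply; first exact: memvD.
  by rewrite xv wv addFF.
- by rewrite CH ?uv.
- rewrite -[u]addr0 -(addvv v) addrA memvD // CH //.
  by rewrite innerDl uv vv addr0.
Qed.

(** * The codes d_n^+ *)

Lemma span_orthogonal n (X : seq 'rV['F_2]_n) u :
  (forall x, x \in X -> inner u x = 0) ->
  forall v, v \in <<X>>%VS -> inner u v = 0.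
Proof.
move=> uX v vX; apply/eqP; rewrite innerC -mem_hyperplane.
apply: (subvP _ v vX); apply/span_subvP=> x xX.
by rewrite mem_hyperplane innerC uX.
Qed.

Lemma span_doubly_even n (X : seq 'rV['F_2]_n) :
  (forall x, x \in X -> (4 %| weight x)%N) ->
  (forall x y, x \in X -> y \in X -> inner x y = 0) ->
  forall u, u \in <<X>>%VS -> (4 %| weight u)%N.
Proof.
elim: X => [|x X IH] X4 XX u.
  rewrite span_nil memv0 => /eqP->.
  by rewrite (eqP (_ : weight 0 == 0%N)) // weight_eq0.
rewrite span_cons => /memv_addP[_ /vlineP[c ->] [v vX ->]].
have v4 : (4 %| weight v)%N.
  apply: IH vX => [y yX|y z yX zX]; first by rewrite X4 ?inE ?yX ?orbT.
  by rewrite XX ?inE ?yX ?zX ?orbT.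
case: (F2_cases c) => ->; first by rewrite scale0r add0r.
rewrite scale1r weight_add_dvd4 // ?X4 ?inE ?eqxx //.
by apply: span_orthogonal vX => y yX; rewrite XX ?inE ?eqxx ?yX ?orbT.
Qed.

(** The dual of C is the kernel of \dim C linear forms. *)
Lemma self_dual_dim n (C : binary_code n) : self_dual C -> (n <= 2 * \dim C)%N.
Proof.
move=> sC; pose B : 'M['F_2]_(\dim C, n) := \matrix_i tnth (vbasis C) i.
pose h : 'Hom('rV['F_2]_n, 'rV['F_2]_(\dim C)) := linfun (mulmxr B^T).
have kerC : (lker h <= C)%VS.
  apply/subvP=> u; rewrite memv_ker lfunE /= => /eqP uB.
  apply: self_dual_mem => // v; rewrite -(span_basis (vbasisP C)).
  apply: span_orthogonal => x /tnthP[i ->].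
  move/matrixP/(_ 0 i): uB; rewrite !mxE => uB; rewrite -[RHS]uB.
  by apply: eq_bigr => k _; rewrite !mxE.
have := limg_ker_dim h fullv; rewrite capfv dimvf => dimE; have := dimvS kerC.
have := dimvS (subvf (limg h)); move: dimE.
have dim_rV k : dim 'rV['F_2]_k = k by rewrite /dim /= mul1n.
rewrite dimvf !dim_rV => /esym/eq_leq nE ? ?; apply: (leq_trans nE).
by rewrite mul2n -addnn leq_add.
Qed.

Section Blocks.
Variable m : nat.
Implicit Types (i j : 'I_m) (u v : 'rV['F_2]_m.*2).

Lemma lo_subproof i : (i.*2 < m.*2)%N. Proof. by rewrite ltn_double. Qed.
Lemma hi_subproof i : (i.*2.+1 < m.*2)%N.
Proof. by rewrite ltn_Sdouble. Qed.
Definition lo i : 'I_m.*2 := Ordinal (lo_subproof i).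
Definition hi i : 'I_m.*2 := Ordinal (hi_subproof i).

Lemma half_subproof (k : 'I_m.*2) : (k./2 < m)%N.
Proof. by rewrite ltn_half_double. Qed.
Definition block_of k : 'I_m := Ordinal (half_subproof k).

Lemma lo_or_hi (k : 'I_m.*2) :
  k = if odd k then hi (block_of k) else lo (block_of k).
Proof.
by apply: val_inj; have := odd_double_half k; case: ifP => /= _ {1}<-.
Qed.

Lemma block_of_lo i : block_of (lo i) = i.
Proof. by apply: val_inj; rewrite /= doubleK. Qed.
Lemma block_of_hi i : block_of (hi i) = i.
Proof. by apply: val_inj; rewrite /= uphalf_double. Qed.

Lemma big_blocks (V : nmodType) (F : 'I_m.*2 -> V) :
  \sum_k F k = \sum_i (F (lo i) + F (hi i)).
Proof.
rewrite (partition_big block_of predT) //=; apply: eq_bigr => i _.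
have lohi : lo i != hi i by apply/eqP=> /(congr1 val) /=; lia.
rewrite (bigD1 (lo i)) ?block_of_lo //= (bigD1 (hi i)); last first.
  by rewrite block_of_hi eqxx eq_sym.
rewrite /= big1 ?addr0 // => k /andP[/andP[/eqP <- k_lo] k_hi].
by have := lo_or_hi k; case: ifP => _ /eqP; rewrite (negPf k_lo, negPf k_hi).
Qed.

Lemma row_blocks u v :
  (forall i, u 0 (lo i) = v 0 (lo i)) -> (forall i, u 0 (hi i) = v 0 (hi i)) ->
  u = v.
Proof. by move=> ul uh; apply/rowP=> k; rewrite [k]lo_or_hi; case: ifP. Qed.

(** The words of d_n^+ have constant block sums; a word with zero block sums
    repeats each of its coordinates. *)
Definition pairsum u i : 'F_2 := u 0 (lo i) + u 0 (hi i).

Lemma pairsumD u v i : pairsum (u + v) i = pairsum u i + pairsum v i.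
Proof. by rewrite /pairsum !mxE addrACA. Qed.

Lemma inner_blocks u v :
  inner u v = \sum_i (u 0 (lo i) * v 0 (lo i) + u 0 (hi i) * v 0 (hi i)).
Proof. by rewrite /inner big_blocks. Qed.

Lemma weight_blocks u :
  weight u = (\sum_i ((u 0%R (lo i) != 0%R) + (u 0%R (hi i) != 0%R)))%N.
Proof.
rewrite /weight -sum1_card big_mkcond.
have -> : (\sum_(k < m.*2) (if k \in [set i | u 0%R i != 0%R]%SET then 1 else 0) =
          \sum_k (u 0%R k != 0%R : nat))%N.
  by apply: eq_bigr => k _; rewrite inE; case: (_ != _).
exact: (big_blocks (fun k => (u 0 k != 0 : nat))).
Qed.

Lemma glueE_lo i : dplus_glue m.*2 0 (lo i) = 1.
Proof. by rewrite mxE /= odd_double. Qed.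
Lemma glueE_hi i : dplus_glue m.*2 0 (hi i) = 0.
Proof. by rewrite mxE /= odd_double. Qed.

Lemma genE_lo i j :
  dplus_gen m.*2 i.+1 0 (lo j) = ((j == 0 :> nat) || (j == i))%:R.
Proof.
rewrite mxE /=; congr (nat_of_bool _)%:R; rewrite !inE -val_eqE /=.
by apply/idP/idP; lia.
Qed.
Lemma genE_hi i j :
  dplus_gen m.*2 i.+1 0 (hi j) = ((j == 0 :> nat) || (j == i))%:R.
Proof.
rewrite mxE /=; congr (nat_of_bool _)%:R; rewrite !inE -val_eqE /=.
by apply/idP/idP; lia.
Qed.

Lemma inner_glue u : inner u (dplus_glue m.*2) = \sum_i u 0 (lo i).
Proof.
rewrite inner_blocks; apply: eq_bigr => i _.
by rewrite glueE_lo glueE_hi mulr1 mulr0 addr0.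
Qed.

Variable m_gt0 : (0 < m)%N.
Let o : 'I_m := Ordinal m_gt0.

Lemma inner_gen u i : i != o ->
  inner u (dplus_gen m.*2 i.+1) = pairsum u o + pairsum u i.
Proof.
move=> i_o; rewrite inner_blocks.
under eq_bigr => j _ do rewrite genE_lo genE_hi -mulrDl.
rewrite (bigD1 o) //= mulr1 (bigD1 i) //= eqxx orbT mulr1 big1 ?addr0 //.
move=> j /andP[jo /negPf ->].
by rewrite orbF; move: jo; rewrite -val_eqE /= => /negPf->; rewrite mulr0.
Qed.

Definition dplus_basis : seq 'rV['F_2]_m.*2 :=
  dplus_glue m.*2 ::
  [seq dplus_gen m.*2 k | k <- index_iota 2 (m.*2 %/ 2).+1].

Lemma dplus_basisP x :
  reflect (x = dplus_glue m.*2 \/ exists2 i, i != o & x = dplus_gen m.*2 i.+1)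
    (x \in dplus_basis).
Proof.
rewrite /dplus_basis divn2 doubleK inE.
apply: (iffP orP).
  case=> [/eqP|]; first by left.
  case/mapP=> k; rewrite mem_index_iota => /andP[k2 km] ->; right.
  have k1 : (k.-1 < m)%N by lia.
  exists (Ordinal k1); first by rewrite -val_eqE /=; lia.
  by rewrite /= prednK //; lia.
case=> [->|[i i_o ->]]; first by left.
right; apply/mapP; exists i.+1 => //; rewrite mem_index_iota.
by have := ltn_ord i; move: i_o; rewrite -val_eqE /=; lia.
Qed.

(** Orthogonality to the generators of d_n^+, spelled out on blocks. *)
Definition dplus_checks u :=
  [forall i, pairsum u i == pairsum u o] && (\sum_i u 0 (lo i) == 0).

Lemma dplus_checksP u :
  reflect (forall x, x \in dplus_basis ->
           inner u x = 0) (dplus_checks u).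
Proof.
apply: (iffP andP) => [[/forallP eq_u /eqP u0] x /dplus_basisP|uX].
  case=> [->|[i i_o ->]]; first by rewrite inner_glue.
  by rewrite inner_gen // (eqP (eq_u i)) addFF.
split; last by rewrite -inner_glue uX ?inE ?eqxx.
apply/forallP=> i; have [->//|i_o] := eqVneq i o.
apply/eqP/esym/addF_eq0; rewrite -inner_gen //; apply: uX.
by apply/dplus_basisP; right; exists i.
Qed.

Hypothesis m4 : (4 %| m)%N.

Lemma natr_m : m%:R = 0 :> 'F_2.
Proof. by apply/eqP; rewrite natF2_eq0; lia. Qed.

Lemma dplus_basis_checks x : x \in dplus_basis ->
  dplus_checks x /\ (4 %| weight x)%N.
Proof.
case/dplus_basisP=> [->|[i i_o ->]].
  split.
    apply/andP; split.
      by apply/forallP=> i; rewrite /pairsum !glueE_lo !glueE_hi.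
    under eq_bigr => i _ do rewrite glueE_lo.
    by rewrite sumr_const card_ord natr_m.
  rewrite weight_blocks; under eq_bigr => i _ do rewrite glueE_lo glueE_hi /=.
  by rewrite sum1_card card_ord.
split.
  apply/andP; split.
    by apply/forallP=> j; rewrite /pairsum !genE_lo !genE_hi !addFF.
  rewrite (bigD1 o) //= (bigD1 i) //= !genE_lo eqxx orbT big1 ?addr0 // => j.
  case/andP=> jo /negPf ji; rewrite genE_lo ji orbF.
  by move: jo; rewrite -val_eqE /= => /negPf->.
rewrite weight_blocks (bigD1 o) //= (bigD1 i) //= big1; last first.
  move=> j /andP[jo /negPf ji]; rewrite genE_lo genE_hi ji orbF.
  by move: jo; rewrite -val_eqE /= => /negPf->.
by rewrite !genE_lo !genE_hi eqxx orbT.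
Qed.

(** A word u that passes the checks has constant block sum c.  After addition
    of c times the glue word all blocks become 00 or 11, the number of 11 is
    even by the last check, and such a word is a sum of the generators of its
    nonzero blocks other than the first. *)
Lemma mem_dplus u : (u \in dplus m.*2) = dplus_checks u.
Proof.
apply/idP/idP => [uD|].
  apply/dplus_checksP => x xX; rewrite innerC.
  apply: span_orthogonal uD; apply/dplus_checksP.
  by case: (dplus_basis_checks xX).
have double_mem v : (forall i, pairsum v i = 0) -> \sum_i v 0 (lo i) = 0 ->
    v \in dplus m.*2.
  move=> v0 sv0.
  have hiE i : v 0 (hi i) = v 0 (lo i).
    by apply/esym/addF_eq0/v0.
  suff -> : v = \sum_(i | i != o) v 0 (lo i) *: dplus_gen m.*2 i.+1.
    apply: memv_suml => i i_o; apply/memvZ/memv_span/dplus_basisP.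
    by right; exists i.
  have coord j : v 0 (lo j) =
      \sum_(i | i != o) v 0 (lo i) * ((j == 0 :> nat) || (j == i))%:R.
    have [->|j_o] := eqVneq j o.
      under eq_bigr => i _ do rewrite /= mulr1.
      by apply: addF_eq0; apply: etrans sv0; rewrite [RHS](bigD1 o).
    rewrite (bigD1 j) //= eqxx orbT mulr1 big1 ?addr0 // => i /andP[_ ij].
    move: j_o; rewrite -val_eqE /= => /negPf->.
    by rewrite eq_sym (negPf ij) mulr0.
  apply: row_blocks => j; rewrite ?hiE {1}coord summxE.
    by apply: eq_bigr => i _; rewrite mxE genE_lo.
  by apply: eq_bigr => i _; rewrite mxE genE_hi.
have glueD : dplus_glue m.*2 \in dplus m.*2.
  by apply: memv_span; rewrite inE eqxx.
case/andP=> /forallP eq_u /eqP u0.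
rewrite -[u]addr0 -(addvv (pairsum u o *: dplus_glue m.*2)) addrA.
apply: memvD; last exact: memvZ.
apply: double_mem => [i|].
  rewrite pairsumD (eqP (eq_u i)) {2}/pairsum !mxE.
  rewrite /= !odd_double /= mulr1 mulr0 addr0; exact: addFF.
under eq_bigr => i _ do rewrite mxE [X in _ + X]mxE glueE_lo mulr1.
by rewrite big_split /= u0 sumr_const card_ord -mulr_natr natr_m mulr0 addr0.
Qed.

Lemma dplus_typeII : typeII (dplus m.*2).
Proof.
have orth x y : x \in dplus m.*2 -> y \in dplus m.*2 -> inner x y = 0.
  by rewrite mem_dplus => /dplus_checksP xX; apply: span_orthogonal.
split=> [u|].
  apply/idP/dual_codeP => [uD v vD|uD]; first exact: orth.
  by rewrite mem_dplus; apply/dplus_checksP => x xX; apply/uD/memv_span.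
apply: span_doubly_even => [x /dplus_basis_checks[]//|x y xX yX].
by apply: orth; apply: memv_span.
Qed.

Lemma dim_dplus : \dim (dplus m.*2) = m.
Proof.
have := self_dual_dim (proj1 dplus_typeII).
have := dim_span (dplus_basis).
rewrite -/(dplus m.*2) /= size_map size_iota divn2 doubleK.
by move: (\dim _) => d; lia.
Qed.

End Blocks.

(** * Permutations of coordinates *)

Lemma supp_col_perm n (s : 'S_n) (u : 'rV['F_2]_n) :
  supp (col_perm s u) = (s @^-1: supp u)%SET.
Proof. by apply/setP=> i; rewrite !inE mxE. Qed.

Lemma weight_col_perm n (s : 'S_n) (u : 'rV['F_2]_n) :
  weight (col_perm s u) = weight u.
Proof.
rewrite -[LHS]/#|supp (col_perm s u)| supp_col_perm card_preimset //.
exact: perm_inj.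
Qed.

Lemma inner_col_perm n (s : 'S_n) (u v : 'rV['F_2]_n) :
  inner (col_perm s u) (col_perm s v) = inner u v.
Proof.
rewrite /inner [RHS](reindex_inj (@perm_inj _ s)).
by apply: eq_bigr => i _; rewrite !mxE.
Qed.

Lemma col_permKV n (s : 'S_n) : cancel (@col_perm 'F_2 1 n s^-1%g) (col_perm s).
Proof. by move=> u; apply/rowP=> i; rewrite !mxE permK. Qed.
Lemma col_permK n (s : 'S_n) : cancel (@col_perm 'F_2 1 n s) (col_perm s^-1%g).
Proof. by move=> u; apply/rowP=> i; rewrite !mxE permKV. Qed.

(** Equivalent codes have equal triple sums. *)
Lemma triple_sum_col_perm f n (s : 'S_n) (C C' : pred 'rV['F_2]_n) :
  (forall u, C u = C' (col_perm s u)) -> triple_sum f C = triple_sum f C'.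
Proof.
move=> CE; have re (V : nmodType) (F : 'rV['F_2]_n -> V) :
    \sum_(x | C' x && (weight x == 4%N)) F x =
    \sum_(x | C x && (weight x == 4%N)) F (col_perm s x).
  rewrite (reindex (col_perm s)); last first.
    by exists (col_perm s^-1%g) => u _; rewrite ?col_permK ?col_permKV.
  by apply: eq_bigl => x; rewrite CE weight_col_perm.
rewrite /triple_sum re; apply: eq_bigr => x _.
rewrite re; apply: eq_bigr => y _; rewrite re; apply: eq_bigr => z _.
have cardV (A : {set 'I_n}) : #|(s @^-1: A)%SET| = #|A|.
  by rewrite card_preimset //; exact: perm_inj.
by rewrite !supp_col_perm -!preimsetI !cardV.
Qed.

(** * Words as bit sequences *)

Definition bits n (u : 'rV['F_2]_n) : bitseq :=
  [seq u 0 i != 0 | i <- enum 'I_n].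

Definition word n (l : bitseq) : 'rV['F_2]_n := \row_(j < n) (nth false l j)%:R.

Definition meet (l l' : bitseq) : bitseq := [seq p.1 && p.2 | p <- zip l l'].
Definition wt (l : bitseq) : nat := count id l.
Definition dot (l l' : bitseq) : bool := odd (wt (meet l l')).
Definition bxor (l l' : bitseq) : bitseq := [seq p.1 (+) p.2 | p <- zip l l'].

Lemma bits_row n (b : nat -> bool) : bits (\row_(j < n) (b j)%:R) = mkseq b n.
Proof.
rewrite /mkseq -val_enum_ord -map_comp; apply: eq_map => i /=.
by rewrite mxE; case: (b i).
Qed.

Lemma size_bits n (u : 'rV['F_2]_n) : size (bits u) = n.
Proof. by rewrite size_map size_enum_ord. Qed.

Lemma bits_word n l : size l = n -> bits (word n l) = l.
Proof. by move=> sl; rewrite bits_row -sl mkseq_nth. Qed.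

Lemma bitsK n : cancel (@bits n) (@word n).
Proof.
move=> u; apply/rowP=> i; rewrite mxE (nth_map i) ?size_enum_ord //.
by rewrite nth_ord_enum; case: (F2_cases (u 0 i)) => ->.
Qed.

Lemma wt_map_enum n (P : pred 'I_n) :
  wt [seq P i | i <- enum 'I_n] = #|[set i | P i]%SET|.
Proof.
by rewrite /wt count_map cardsE cardE enumT size_filter; apply: eq_count.
Qed.

Lemma meet_bits n (u v : 'rV['F_2]_n) :
  meet (bits u) (bits v) = [seq i \in (supp u :&: supp v)%SET | i <- enum 'I_n].
Proof.
rewrite /meet zip_map -map_comp; apply: eq_map => i /=; by rewrite !inE.
Qed.

Lemma wt_bits n (u : 'rV['F_2]_n) : wt (bits u) = weight u.
Proof. exact: wt_map_enum. Qed.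

Lemma wt_meet n (u v : 'rV['F_2]_n) :
  wt (meet (bits u) (bits v)) = #|supp u :&: supp v|%SET.
Proof. by rewrite meet_bits wt_map_enum; apply: eq_card => i; rewrite inE. Qed.

Lemma wt_meet3 n (u v w : 'rV['F_2]_n) :
  wt (meet (meet (bits u) (bits v)) (bits w)) =
  #|supp u :&: supp v :&: supp w|%SET.
Proof.
rewrite meet_bits /meet zip_map -map_comp wt_map_enum.
by apply: eq_card => i; rewrite !inE.
Qed.

Lemma dot_bits n (u v : 'rV['F_2]_n) : dot (bits u) (bits v) = (inner u v != 0).
Proof. by rewrite /dot wt_meet inner_eq0 negbK. Qed.

Lemma bits_add n (u v : 'rV['F_2]_n) : bits (u + v) = bxor (bits u) (bits v).
Proof.
rewrite /bxor zip_map -map_comp; apply: eq_map => i /=; rewrite mxE.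
by case: (F2_cases (u 0 i)) => ->; case: (F2_cases (v 0 i)) => ->.
Qed.

(** All bit sequences of length [n] and weight [w]. *)
Fixpoint words (n w : nat) : seq bitseq :=
  match n, w with
  | 0, 0 => [:: [::]]
  | 0, _.+1 => [::]
  | n'.+1, 0 => [seq false :: l | l <- words n' 0]
  | n'.+1, w'.+1 => [seq true :: l | l <- words n' w'] ++
                    [seq false :: l | l <- words n' w]
  end.

Lemma mem_map_cons (b c : bool) (l : bitseq) (s : seq bitseq) :
  (b :: l \in [seq c :: x | x <- s]) = (b == c) && (l \in s).
Proof.
apply/mapP/andP => [[x xs [-> ->]]|[/eqP -> ls]]; first by rewrite eqxx.
by exists l.
Qed.

Lemma nil_map_cons (c : bool) (s : seq bitseq) :
  ([::] \in [seq c :: x | x <- s]) = false.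
Proof. by apply/mapP=> -[]. Qed.

Lemma mem_words n w l : (l \in words n w) = (size l == n) && (wt l == w).
Proof.
elim: n w l => [|n IH] [|w] [|b l] //=.
- by rewrite nil_map_cons.
- by rewrite mem_map_cons IH /wt /=; case: b; rewrite ?andbF //= eqSS.
- by rewrite mem_cat !nil_map_cons.
- rewrite mem_cat !mem_map_cons !IH /wt /= eqSS.
  by case: b; rewrite /= ?orbF ?add0n ?add1n ?eqSS.
Qed.

Lemma uniq_words n w : uniq (words n w).
Proof.
elim: n w => [|n IH] [|w] //=; first by rewrite map_inj_uniq ?IH // => ? ? [].
rewrite cat_uniq !map_inj_uniq ?IH; try by move=> ? ? [].
rewrite /= andbT; apply/hasPn=> _ /mapP[l _ ->].
by rewrite mem_map_cons.
Qed.

Lemma sum_words n w (C : pred 'rV['F_2]_n) (c : pred bitseq)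
    (V : nmodType) (F : bitseq -> V) :
  (forall u, C u = c (bits u)) ->
  \sum_(x | C x && (weight x == w)) F (bits x) =
  \sum_(l <- [seq l <- words n w | c l]) F l.
Proof.
move=> Cc; rewrite -big_enum_cond -big_filter /= -(big_map (@bits n) predT F).
apply: perm_big; apply: uniq_perm.
- by rewrite (map_inj_uniq (can_inj (@bitsK n))) filter_uniq ?enum_uniq.
- by rewrite filter_uniq ?uniq_words.
move=> l; rewrite mem_filter mem_words.
apply/mapP/and3P => [[x]|[cl /eqP sl /eqP wl]].
  rewrite mem_filter mem_enum -wt_bits unfold_in Cc => /andP[/eqP wx cx] ->.
  by rewrite cx size_bits wx !eqxx.
exists (word n l); last by rewrite bits_word.
by rewrite mem_filter mem_enum -wt_bits unfold_in Cc bits_word // cl wl eqxx.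
Qed.

(** A sum that computes, unlike \sum. *)
Definition isum (F : bitseq -> int) (q : seq bitseq) : int :=
  foldr (fun l s => F l + s) 0 q.

Lemma isumE F q : isum F q = \sum_(l <- q) F l.
Proof. by elim: q => [|l q IH]; rewrite ?big_nil //= big_cons IH. Qed.

(** Since [f] is connected, the two inner sums may be restricted to words that
    meet the first one; this keeps the evaluation short. *)
Definition bit_triple_sum (f : nat -> nat -> nat -> nat -> int)
    (q : seq bitseq) : int :=
  isum (fun a =>
    let q_a := [seq b <- q | wt (meet a b) != 0%N] in
    isum (fun b =>
      let ab := meet a b in
      isum (fun c => f (wt ab) (wt (meet a c)) (wt (meet b c)) (wt (meet ab c)))
        q_a) q_a) q.

Lemma triple_sum_bits f n (C : pred 'rV['F_2]_n) (c : pred bitseq) :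
  connected f -> (forall u, C u = c (bits u)) ->
  triple_sum f C = bit_triple_sum f [seq l <- words n 4 | c l].
Proof.
move=> fc Cc; rewrite /triple_sum /bit_triple_sum isumE.
rewrite -(sum_words _ _ Cc); apply: eq_bigr => x _.
rewrite isumE big_filter [RHS]big_mkcond -(sum_words _ _ Cc).
apply: eq_bigr => y _; rewrite wt_meet; case: eqVneq => [xy|_] /=.
  by rewrite big1 // => z _; rewrite xy fc.
rewrite isumE big_filter [RHS]big_mkcond -(sum_words _ _ Cc).
apply: eq_bigr => z _; rewrite !wt_meet wt_meet3.
by case: eqVneq => //= xz; rewrite fc // xz orbT.
Qed.

(** * Normal forms of the neighbors of d_n^+ *)

(** A neighbor of [D] determines v only up to translation by D /\ v^perp. *)
Lemma nbr_mem_shift n (D : binary_code n) v d u :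
  self_dual D -> d \in D -> inner d v = 0 ->
  nbr_mem D (v + d) u = nbr_mem D v u.
Proof.
move=> sD dD dv; rewrite /nbr_mem innerDr addrA.
have [uD|uD] := boolP (u \in D).
  by rewrite (self_dual_inner sD uD dD) addr0.
rewrite /= (_ : (u + v + d \in D) = (u + v \in D)); last first.
  apply/idP/idP => uvD; last exact: memvD.
  by rewrite -[u + v]addr0 -(addvv d) addrA memvD.
have [uvD|_] := boolP (u + v \in D); last by rewrite !andbF.
have := self_dual_inner sD uvD dD.
by rewrite innerDl (innerC v) dv addr0 => ->; rewrite addr0.
Qed.

Section CanonicalNeighbors.
Variables (m : nat) (m_gt0 : (0 < m)%N) (m4 : (4 %| m)%N).
Let o : 'I_m := Ordinal m_gt0.
Implicit Types (i j : 'I_m) (u v : 'rV['F_2]_m.*2) (s : 'S_m).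

(** Permutations of the blocks are automorphisms of d_n^+. *)
Definition move_blocks s (k : 'I_m.*2) : 'I_m.*2 :=
  if odd k then hi (s (block_of k)) else lo (s (block_of k)).

Lemma move_blocks_lo s i : move_blocks s (lo i) = lo (s i).
Proof. by rewrite /move_blocks /= odd_double block_of_lo. Qed.
Lemma move_blocks_hi s i : move_blocks s (hi i) = hi (s i).
Proof. by rewrite /move_blocks /= odd_double block_of_hi. Qed.

Lemma move_blocks_inj s : injective (move_blocks s).
Proof.
apply: (can_inj (g := move_blocks s^-1%g)) => k; rewrite {1}[k]lo_or_hi.
rewrite [RHS]lo_or_hi; case: ifP => _.
  by rewrite !move_blocks_hi permK.
by rewrite !move_blocks_lo permK.
Qed.

Definition block_perm s : 'S_(m.*2) := perm (@move_blocks_inj s).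

Lemma block_perm_lo s u i : col_perm (block_perm s) u 0 (lo i) = u 0 (lo (s i)).
Proof. by rewrite mxE permE move_blocks_lo. Qed.
Lemma block_perm_hi s u i : col_perm (block_perm s) u 0 (hi i) = u 0 (hi (s i)).
Proof. by rewrite mxE permE move_blocks_hi. Qed.
Lemma pairsum_block_perm s u i :
  pairsum (col_perm (block_perm s) u) i = pairsum u (s i).
Proof. by rewrite /pairsum block_perm_lo block_perm_hi. Qed.

Lemma mem_dplus_block_perm s u :
  (col_perm (block_perm s) u \in dplus m.*2) = (u \in dplus m.*2).
Proof.
rewrite !(mem_dplus m_gt0 m4) /dplus_checks; congr andb; last congr (_ == _).
  apply/forallP/forallP => /= eq_u i.
    have := eq_u (s^-1 i)%g; have := eq_u (s^-1 o)%g.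
    by rewrite !pairsum_block_perm !permKV => /eqP->.
  by rewrite !pairsum_block_perm (eqP (eq_u (s i))) (eqP (eq_u (s o))).
rewrite [RHS](reindex_inj (@perm_inj _ s)).
by apply: eq_bigr => i _; rewrite block_perm_lo.
Qed.

Lemma nbr_mem_block_perm s v u :
  nbr_mem (dplus m.*2) (col_perm (block_perm s) v) (col_perm (block_perm s) u) =
  nbr_mem (dplus m.*2) v u.
Proof.
rewrite /nbr_mem inner_col_perm mem_dplus_block_perm.
rewrite (_ : _ + _ = col_perm (block_perm s) (u + v)) ?mem_dplus_block_perm //.
by apply/rowP=> k; rewrite !mxE.
Qed.

(** The blocks of sum 1 can be moved to the front. *)
Lemma sort_pairsums v :
  exists s (k : nat), (k <= m)%N /\ forall i, pairsum v (s i) = (i < k)%N%:R.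
Proof.
pose t := [tuple pairsum v i != 0 | i < m].
have /tuple_permP[s Es] : perm_eq (filter id t ++ filter (predC id) t) t.
  by rewrite perm_filterC.
exists s, (count id t); split=> [|i].
  by rewrite -[X in (_ <= X)%N](size_tuple t) count_size.
have := congr1 (fun l => nth false l i) Es.
rewrite -tnth_nth !tnth_mktuple nth_cat size_filter.
case: ltnP => [i_lt|i_ge].
  have /(mem_nth false) : (i < size (filter id t))%N by rewrite size_filter.
  by rewrite mem_filter => /andP[/= -> _] /esym; rewrite F2_neq0 => /eqP.
have lt : (i - count id t < size (filter (predC id) t))%N.
  rewrite size_filter -(ltn_add2l (count id t)) subnKC // count_predC.
  by rewrite size_tuple.
move: (mem_nth false lt); rewrite mem_filter => /andP[/= /negPf -> _].
by move/esym/negbFE/eqP.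
Qed.

(** The word with [k] blocks 10 followed by blocks 00, where the first of the
    [k] blocks is 01 if [d], and the last of the other blocks is 11 if [e]. *)
Definition canon_bit (k : nat) (d e : bool) (j : nat) : bool :=
  if (j./2 < k)%N then ((j./2 == 0%N) && d) (+) ~~ odd j
  else (j./2 == m.-1) && e.

Definition canon k d e : 'rV['F_2]_m.*2 :=
  \row_(j < m.*2) (canon_bit k d e j)%:R.

Lemma canon_lo k d e i : canon k d e 0 (lo i) =
  if (i < k)%N then 1 + ((i == o) && d)%:R else ((i == m.-1 :> nat) && e)%:R.
Proof.
rewrite mxE /canon_bit /= doubleK odd_double -val_eqE /=; case: ifP => // _.
by rewrite addbT; case: (_ && _); rewrite ?addFF ?addr0.
Qed.

Lemma pairsum_canon k d e i : pairsum (canon k d e) i = (i < k)%N%:R.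
Proof.
rewrite /pairsum !mxE /canon_bit /= doubleK uphalf_double odd_double /=.
case: ifP => _; last by rewrite addFF.
by rewrite addbT addbF; case: (_ && _); rewrite ?addr0 ?add0r.
Qed.

(** If v has block sum 1 exactly on the first k blocks, then so does
    [canon k d e], and their difference w repeats its coordinates.  It lies in
    D if it has an even number of blocks 11, and is orthogonal to v if this
    number is even on the first k blocks.  So there is one parity to be fixed
    on each of the two parts, which d and e do. *)
Lemma reduce_to_canon v (k : nat) :
  (k <= m)%N -> (forall i, pairsum v i = (i < k)%N%:R) ->
  exists d e, inner (canon k d e) (canon k d e) = inner v v /\
    forall u, nbr_mem (dplus m.*2) (canon k d e) u = nbr_mem (dplus m.*2) v u.
Proof.
move=> le_km v_k.
pose a : 'F_2 := \sum_(i < m | (i < k)%N) (v 0 (lo i) + 1).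
pose b : 'F_2 := \sum_(i < m | ~~ (i < k)%N) v 0 (lo i).
have bitK (x : 'F_2) : (x != 0)%:R = x by case: (F2_cases x) => ->.
(* d and e are the parities of blocks to be corrected before and after k *)
exists (a != 0), (b != 0).
set c := canon k _ _; pose w := v + c.
have w_lo : \sum_(i < m | (i < k)%N) w 0 (lo i) = 0.
  under eq_bigr => i ik do rewrite mxE canon_lo ik addrA.
  rewrite big_split /= -/a.
  have [k0|k_gt0] := posnP k.
    by rewrite /a !big_pred0 ?addr0 // => i; rewrite k0.
  rewrite (bigD1 o) //= ?eqxx big1 ?addr0 => [|i /andP[_ /negPf->] //].
  by rewrite bitK addFF.
have w_hi : \sum_(i < m | ~~ (i < k)%N) w 0 (lo i) = 0.
  under eq_bigr => i /negPf ik do rewrite mxE canon_lo ik.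
  rewrite big_split /= -/b.
  have [km|lt_km] := eqVneq k m.
    by rewrite /b !big_pred0 ?addr0 // => i; rewrite km ltn_ord.
  have m1 : (m.-1 < m)%N by rewrite prednK.
  rewrite (bigD1 (Ordinal m1)) /=; last by lia.
  rewrite ?eqxx bitK big1 ?addr0 ?addFF // => i /andP[_].
  by rewrite -val_eqE /= => /negPf->.
have pw i : pairsum w i = 0 by rewrite pairsumD v_k pairsum_canon addFF.
have wD : w \in dplus m.*2.
  rewrite (mem_dplus m_gt0 m4); apply/andP; split.
    by apply/forallP=> i; rewrite !pw.
  by rewrite (bigID (fun i : 'I_m => (i < k)%N)) /= w_lo w_hi addr0.
have wv : inner w v = 0.
  rewrite inner_blocks -[RHS]w_lo [RHS]big_mkcond; apply: eq_bigr => i _.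
  have -> : w 0 (hi i) = w 0 (lo i) by apply/esym/addF_eq0/pw.
  rewrite -mulrDr -/(pairsum v i) v_k; case: ifP => _; by rewrite ?mulr1 ?mulr0.
have -> : c = v + w by rewrite addrA addvv add0r.
clearbody w.
have [sD _] := dplus_typeII m_gt0 m4; split=> [|u].
  rewrite innerDl !innerDr wv (innerC v) wv (self_dual_inner sD wD wD).
  by rewrite !addr0.
exact: nbr_mem_shift wD wv.
Qed.

End CanonicalNeighbors.

(** * Evaluation of the triple sums *)

(** Written with [if] rather than with [all], so that call-by-value evaluation
    stops at the first generator that fails; the same holds of [nbr_bits]. *)
Fixpoint orthogonal (G : seq bitseq) (l : bitseq) : bool :=
  if G is g :: G' then if dot l g then false else orthogonal G' l else true.

Definition nbr_bits (P : pred bitseq) (v l : bitseq) : bool :=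
  if dot l v then false else if P l then true else P (bxor l v).

Definition dplus_bits (m : nat) : seq bitseq :=
  mkseq (fun j => odd j.+1) m.*2 ::
  [seq mkseq (fun j => j.+1 \in [:: 1; 2; 2 * k - 1; 2 * k]%N) m.*2
     | k <- index_iota 2 m.+1].

Lemma orthogonal_bits n (X : seq 'rV['F_2]_n) u :
  orthogonal [seq bits x | x <- X] (bits u) = all (fun x => inner u x == 0) X.
Proof. by elim: X => //= x X ->; rewrite dot_bits; case: eqP. Qed.

Lemma mem_dplus_bits m (u : 'rV['F_2]_m.*2) : (0 < m)%N -> (4 %| m)%N ->
  (u \in dplus m.*2) = orthogonal (dplus_bits m) (bits u).
Proof.
move=> m_gt0 m4; have -> : dplus_bits m = [seq bits x | x <- dplus_basis m].
  rewrite /dplus_basis divn2 doubleK map_cons -map_comp; congr cons.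
    exact/esym/bits_row.
  by apply: eq_map => k; apply/esym/bits_row.
rewrite orthogonal_bits (mem_dplus m_gt0 m4).
apply/dplus_checksP/allP => h x /h; first by move->.
by move/eqP.
Qed.

Lemma nbr_mem_bits n (D : binary_code n) (P : pred bitseq) v :
  (forall u, (u \in D) = P (bits u)) ->
  forall u, nbr_mem D v u = nbr_bits P (bits v) (bits u).
Proof.
move=> DP u; rewrite /nbr_mem /nbr_bits !DP bits_add dot_bits.
by case: eqP => //= _; case: (P _).
Qed.

Definition canon_bits m k d e : bitseq := mkseq (canon_bit m k d e) m.*2.

(** Only words of doubly even weight can lie in a Type II neighbor.  The case
    k = 0 yields the zero word, hence d_n^+ itself. *)
Definition canon_words (m : nat) : seq bitseq :=
  undup [seq l <- [seq canon_bits m k de.1 de.2 | k <- iota 0 m.+1,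
                     de <- [:: (false, false); (false, true);
                               (true, false); (true, true)]]
        | (4 %| wt l)%N].

(** The [let]s share the generators and the candidate words between all
    evaluations. *)
Definition neighbor_sums (f : nat -> nat -> nat -> nat -> int) (m : nat) :
    seq int :=
  let G := dplus_bits m in let W := words m.*2 4 in
  [seq bit_triple_sum f [seq l <- W | nbr_bits (orthogonal G) v l]
     | v <- canon_words m].

(** Reduces the statement on all neighbors of d_n^+ to the finite list of
    normal forms. *)
Lemma triple_sum_neighbor f mu m (C : binary_code m.*2) :
  (0 < m)%N -> (4 %| m)%N -> connected f ->
  all (pred1 (mu * (m.*2)%:Z)) (neighbor_sums f m) ->
  typeII C -> C = dplus m.*2 \/ neighbors C (dplus m.*2) ->
  triple_sum f (mem C) = mu * (m.*2)%:Z.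
Proof.
move=> m_gt0 m4 fc ok [sC C4] CD.
have [v vv Cv] : exists2 v, inner v v = 0 &
    forall u, (u \in C) = nbr_mem (dplus m.*2) v u.
  case: CD => [->|CD].
    exists 0; rewrite ?inner0l // => u.
    by rewrite /nbr_mem innerC inner0l eqxx addr0 orbb.
  by apply: neighbor_of CD _; rewrite dim_dplus // divn2 doubleK.
have [s [k [le_km v_k]]] := sort_pairsums v.
pose v' := col_perm (block_perm s) v.
have [i|d [e [cc cE]]] := reduce_to_canon m_gt0 m4 (v := v') le_km.
  by rewrite pairsum_block_perm.
rewrite inner_col_perm vv in cc; set c := canon m k d e in cc cE.
have CE u : (u \in C) = nbr_mem (dplus m.*2) c (col_perm (block_perm s) u).
  by rewrite cE nbr_mem_block_perm.
have c4 : (4 %| weight c)%N.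
  rewrite -(col_permKV (block_perm s) c) weight_col_perm; apply: C4.
  by rewrite CE col_permKV /nbr_mem cc addvv mem0v orbT.
rewrite (triple_sum_col_perm (s := block_perm s) f
           (C' := nbr_mem (dplus m.*2) c)) //.
have cP := nbr_mem_bits c (fun u => mem_dplus_bits u m_gt0 m4).
rewrite (triple_sum_bits fc cP).
apply/eqP; apply: (allP ok); apply/mapP; exists (bits c) => //.
rewrite mem_undup mem_filter wt_bits c4 andTb.
apply/allpairsP; exists (k, (d, e)); split; last exact: bits_row.
  by rewrite mem_iota add0n ltnS.
by case: d {cE c cc CE c4 cP} => //; case: e.
Qed.

(** The four patterns are three equal words; x and y = z meeting in two
    points; three words through two common points, as in d_8; three words
    which meet pairwise in two points and all in one, as in e_7. *)
Definition pattern_weight (a b c d : int) (i j k l : nat) : int :=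
  match i, j, k, l with
  | 4, 4, 4, 4 => a
  | 2, 2, 4, 2 => b
  | 2, 2, 2, 2 => c
  | 2, 2, 2, 1 => d
  | _, _, _, _ => 0
  end.

Lemma connected_pattern_weight a b c d : connected (pattern_weight a b c d).
Proof.
move=> i j k l /or3P[] /eqP->.
- by [].
- by case: i => [|[|[|[|[]]]]].
- by case: i => [|[|[|[|[]]]]] //; case: j => [|[|[|[|[]]]]].
Qed.

(** If each coordinate lies in eta weight-4 words, the triple sums are
    385 n + n (eta - 5) (eta - 7) (eta - 11) and 77 n - n (eta - 7) (eta - 11).
    The last two patterns enter with weights 2 : 1 because only this
    combination of their numbers is a polynomial in eta. *)
Definition weightA := pattern_weight 580 (-40) 2 1.
Definition weightD := pattern_weight 68 (-2) 0 0.

(** In these lengths d_n^+ and its neighbors have eta = 5, 7 or 11. *)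
Lemma neighbor_sums_weightA m : m \in [:: 4; 8; 12]%N ->
  all (pred1 (385 * (m.*2)%:Z)) (neighbor_sums weightA m).
Proof.
move: m; apply/allP.
vm_cast_no_check (erefl true).
Qed.

Definition code_sum f n (P : pred bitseq) : int :=
  bit_triple_sum f [seq l <- words n 4 | P l].

(** The codes d_8^+, d_16^+ and d_24^+ have eta = 7, 7, 11. *)
Lemma dplus_sums_weightD m : m \in [:: 4; 8; 12]%N ->
  (let G := dplus_bits m in code_sum weightD m.*2 (orthogonal G)) =
  77 * (m.*2)%:Z.
Proof.
move=> mP; apply/eqP; move: m mP; apply/allP.
vm_cast_no_check (erefl true).
Qed.

(** Six blocks 10, five blocks 00, one block 11: splits d_24 into d_12, d_12.
    Then [v2_bits], with two blocks 10 in each half, splits both d_12 into d_4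
    and d_8 and joins the two d_4 to a third d_8. *)
Definition v1_bits : bitseq := canon_bits 12 6 false true.
Definition v2_bits : bitseq := mkseq (fun j => j \in [:: 0; 2; 12; 14]%N) 24.

Definition d12_2_bits : pred bitseq :=
  let G := dplus_bits 12 in let v := v1_bits in nbr_bits (orthogonal G) v.
Definition d8_3_bits : pred bitseq :=
  let G := dplus_bits 12 in let v := v1_bits in let w := v2_bits in
  nbr_bits (nbr_bits (orthogonal G) v) w.

(** Here eta = 5, and the sum differs from 77 * 24 = 1848. *)
Lemma d12_2_sum : code_sum weightD 24 d12_2_bits = 1560.
Proof. by vm_cast_no_check (erefl (1560 : int)). Qed.

(** Here eta = 3, and the sum differs from 385 * 24 = 9240. *)
Lemma d8_3_sum : code_sum weightA 24 d8_3_bits = 7704.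
Proof. by vm_cast_no_check (erefl (7704 : int)). Qed.

Definition code_d12_2 : binary_code 24 := nbr (dplus 24) (word 24 v1_bits).
Definition code_d8_3 : binary_code 24 := nbr code_d12_2 (word 24 v2_bits).

Lemma bits_v1 : bits (word 24 v1_bits) = v1_bits. Proof. exact: bits_word. Qed.
Lemma bits_v2 : bits (word 24 v2_bits) = v2_bits. Proof. exact: bits_word. Qed.

Lemma v1_self : inner (word 24 v1_bits) (word 24 v1_bits) = 0.
Proof. by apply/eqP; rewrite inner_self -wt_bits bits_v1. Qed.
Lemma v2_self : inner (word 24 v2_bits) (word 24 v2_bits) = 0.
Proof. by apply/eqP; rewrite inner_self -wt_bits bits_v2. Qed.

Lemma mem_code_d12_2 u : (u \in code_d12_2) = d12_2_bits (bits u).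
Proof.
rewrite mem_nbr ?v1_self // (nbr_mem_bits (P := orthogonal (dplus_bits 12))).
  by rewrite bits_v1.
by move=> w; exact: (@mem_dplus_bits 12 w isT isT).
Qed.

Lemma mem_code_d8_3 u : (u \in code_d8_3) = d8_3_bits (bits u).
Proof.
by rewrite mem_nbr ?v2_self // (nbr_mem_bits _ mem_code_d12_2) bits_v2.
Qed.

Lemma dplus24_typeII : typeII (dplus 24).
Proof. exact: (@dplus_typeII 12 isT isT). Qed.

Lemma v1_notin : word 24 v1_bits \notin dplus 24.
Proof.
have -> : (word 24 v1_bits \in dplus 24) =
    orthogonal (dplus_bits 12) (bits (word 24 v1_bits)).
  exact: (@mem_dplus_bits 12 _ isT isT).
by rewrite bits_v1.
Qed.

Lemma code_d12_2_typeII : typeII code_d12_2.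
Proof.
apply: nbr_typeII dplus24_typeII v1_notin _.
by rewrite -wt_bits bits_v1.
Qed.

Lemma code_d12_2_neighbor : neighbors code_d12_2 (dplus 24).
Proof.
apply: nbr_neighbors dplus24_typeII v1_notin _ _.
  by rewrite -wt_bits bits_v1.
exact: (@dim_dplus 12 isT isT).
Qed.

Lemma code_d8_3_typeII : typeII code_d8_3.
Proof.
apply: nbr_typeII code_d12_2_typeII _ _; last by rewrite -wt_bits bits_v2.
by rewrite mem_code_d12_2 bits_v2.
Qed.

Lemma triple_sum_code f n (C : binary_code n) (P : pred bitseq) :
  connected f -> (forall u, (u \in C) = P (bits u)) ->
  triple_sum f (mem C) = code_sum f n P.
Proof. by move=> fc CP; apply: triple_sum_bits. Qed.

(** * The three rings *)

Lemma double_of_dvd8 n : (0 < n)%N -> (8 %| n)%N ->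
  exists m, [/\ n = m.*2, (0 < m)%N, (4 %| m)%N &
    (n <= 24)%N -> m \in [:: 4; 8; 12]%N].
Proof.
move=> n_gt0 /dvdnP[k nE]; subst n; exists (4 * k)%N.
split=> [|||k3]; [lia | lia | exact: dvdn_mulr | ].
by move: n_gt0 k3; case: k => [|[|[|[|k]]]] //; lia.
Qed.

Lemma dplus_typeII_dvd8 n : (0 < n)%N -> (8 %| n)%N -> typeII (dplus n).
Proof.
move=> n0 n8; have [m [-> m0 m4 _]] := double_of_dvd8 n0 n8.
exact: dplus_typeII.
Qed.

Lemma subalg_gen_mono (K : fieldType) (A : algType K) (S S' : set A) :
  S `<=` S' -> subalg_gen S `<=` subalg_gen S'.
Proof.
move=> SS' p; elim=> {p} [p /SS' | | p q _ ? _ ? | c p _ ? | p q _ ? _ ?].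
- exact: subalg_gen_in.
- exact: subalg_gen1.
- exact: subalg_genD.
- exact: subalg_genZ.
- exact: subalg_genM.
Qed.

Lemma subalg_gen0 (K : fieldType) (A : algType K) (S : set A) :
  subalg_gen S 0.
Proof. by rewrite -(scale0r 1); apply/subalg_genZ/subalg_gen1. Qed.

(** A homogeneous element of degree at most N outside of the smaller algebra
    stays outside of its truncation, whose elements are sums of elements of the
    algebra. *)
Lemma degree_le_proper (K : fieldType) m (S S' : set {mpoly K[m]}) d N p :
  subalg_gen S `<=` subalg_gen S' -> (d <= N)%N -> p \is d.-homog ->
  subalg_gen S' p -> ~ subalg_gen S p ->
  degree_le (subalg_gen S) N `<` degree_le (subalg_gen S') N.
Proof.
move=> SS' dN p_d S'p Sp; split=> [q [r [rh ->]]|sub].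
  by exists r; split=> // i; have [Sr ri] := rh i; split=> //; apply: SS'.
have [|r [rh pE]] := sub p.
  exists (fun i : 'I_N.+1 => if i == d :> nat then p else 0); split=> [i|].
    by case: eqP => [->|_]; split=> //; [apply: subalg_gen0 | apply: dhomog0].
  have dN1 : (d < N.+1)%N by [].
  rewrite (bigD1 (Ordinal dN1)) //= eqxx big1 ?addr0 // => i.
  by rewrite -val_eqE /= => /negPf->.
apply: Sp; rewrite pE.
elim/big_ind: _ => [|x y|i _]; [exact: subalg_gen0|exact: subalg_genD|].
by have [] := rh i.
Qed.

Lemma weight_enum_homog (K : fieldType) n (C : binary_code n) :
  weight_enum K 3 C \is n.-homog.
Proof.
rewrite weight_enumE rpred_sum // => u _.
by rewrite dhomogX /= mdeg_column_monomial.
Qed.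

Lemma ringD_sub_ringA (K : fieldType) : ringD K 3 `<=` ringA K 3.
Proof.
apply: subalg_gen_mono => p [n [n0 n8 ->]].
by exists n, (dplus n); split=> //; left.
Qed.

Lemma ringA_sub_ringB (K : fieldType) : ringA K 3 `<=` ringB K 3.
Proof.
apply: subalg_gen_mono => p [n [C [n0 n8 CD ->]]].
exists n, C; split=> //.
by case: CD => [->|[]//]; apply: dplus_typeII_dvd8.
Qed.

Lemma d12_2_notin_ringD (K : numFieldType) :
  ~ ringD K 3 (weight_enum K 3 code_d12_2).
Proof.
pose F n (C : binary_code n) := [/\ (0 < n)%N, (8 %| n)%N & C = dplus n].
move=> inD; apply: (@weight_enum_notin_subalg K weightD 77 F code_d12_2).
- exact: connected_pattern_weight.
- by move=> n C [n0 n8 ->]; apply: dplus_typeII_dvd8.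
- move=> n C [n0 n8 ->] n24.
  have [m [nE m0 m4 /(_ n24) mP]] := double_of_dvd8 n0 n8; subst n.
  rewrite -dplus_sums_weightD //; apply: triple_sum_code => [|u].
    exact: connected_pattern_weight.
  exact: mem_dplus_bits.
- rewrite (triple_sum_code (connected_pattern_weight _ _ _ _) mem_code_d12_2).
  by rewrite d12_2_sum.
apply: subalg_gen_mono inD => p [n [n0 n8 ->]].
by exists n, (dplus n); split.
Qed.

Lemma d8_3_notin_ringA (K : numFieldType) :
  ~ ringA K 3 (weight_enum K 3 code_d8_3).
Proof.
pose F n (C : binary_code n) := [/\ (0 < n)%N, (8 %| n)%N &
  C = dplus n \/ typeII C /\ neighbors C (dplus n)].
move=> inA.
have F2 n (C : binary_code n) : F n C -> typeII C.
  by case=> n0 n8 [->|[]//]; apply: dplus_typeII_dvd8.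
apply: (@weight_enum_notin_subalg K weightA 385 F code_d8_3) => //.
- exact: connected_pattern_weight.
- move=> n C FC n24; have C2 := F2 _ _ FC; case: FC => n0 n8 CD.
  have [m [nE m0 m4 /(_ n24) mP]] := double_of_dvd8 n0 n8; subst n.
  apply: triple_sum_neighbor => //.
  + exact: connected_pattern_weight.
  + exact: neighbor_sums_weightA.
  + by case: CD => [|[]]; [left|right].
- rewrite (triple_sum_code (connected_pattern_weight _ _ _ _) mem_code_d8_3).
  by rewrite d8_3_sum.
apply: subalg_gen_mono inA => p [n [C [n0 n8 CD ->]]].
by exists n, C; split.
Qed.

Theorem theorem7p3 (R : realType) :
  degree_le (ringD R[i] 3) 24 `<` degree_le (ringA R[i] 3) 24 /\
  degree_le (ringA R[i] 3) 24 `<` degree_le (ringB R[i] 3) 24.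
Proof.
split.
  apply: (@degree_le_proper _ _ _ _ 24 _ (weight_enum R[i] 3 code_d12_2)) => //.
  - exact: ringD_sub_ringA.
  - exact: weight_enum_homog.
  - apply: subalg_gen_in; exists 24%N, code_d12_2; split=> //; right.
    by split; [exact: code_d12_2_typeII | exact: code_d12_2_neighbor].
  - exact: d12_2_notin_ringD.
apply: (@degree_le_proper _ _ _ _ 24 _ (weight_enum R[i] 3 code_d8_3)) => //.
- exact: ringA_sub_ringB.
- exact: weight_enum_homog.
- apply: subalg_gen_in; exists 24%N, code_d8_3; split=> //; exact: code_d8_3_typeII.
- exact: d8_3_notin_ringA.
Qed.
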